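(* Let $(\mathcal A,\prec,\succ,\curlyvee,\cdot)$ be a twisted tridendriform algebra. (i) $(\mathcal A,\star)$ is an associative algebra, where $x\star y:=x\prec y+x\succ y+x\curlyvee y+x\cdot y$ for $x,y\in\mathcal A$. (ii) Define bilinear maps $\vartriangleright,\vartriangleleft,\theta:\mathcal A\times\mathcal A\to\mathcal A$ by $x\vartriangleright y:=x\succ y$, $x\vartriangleleft y:=x\prec y$, $\theta(x,y):=x\curlyvee y$. Then $(\vartriangleright,\vartriangleleft,\theta)$ is a non-abelian $2$-cocycle on the associative algebra $(\mathcal A,\star)$ with values in the associative algebra $(\mathcal A,\cdot)$. (iii) The identity map $\mathrm{Id}:(\mathcal A,\cdot)\to(\mathcal A,\star)$ is a $(\vartriangleright,\vartriangleleft,\theta)$-twisted Rota-Baxter operator. Moreover, the induced twisted tridendriform algebra structure on $(\mathcal A,\cdot)$, namely $(\mathcal A,\prec_{\mathrm{Id}},\succ_{\mathrm{Id}},\curlyvee_{\mathrm{Id}},\cdot)$, coincides with the given one.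
   Context: All vector spaces are over a fixed field; associative algebras are not assumed unital. A twisted tridendriform algebra is a tuple $(\mathcal A,\prec,\succ,\curlyvee,\cdot)$ of a vector space with four bilinear operations such that, with $x\star y:=x\prec y+x\succ y+x\curlyvee y+x\cdot y$, for all $x,y,z\in\mathcal A$: $(x\prec y)\prec z=x\prec(y\star z)+x\cdot(y\curlyvee z)$; $(x\succ y)\prec z=x\succ(y\prec z)$; $(x\star y)\succ z+(x\curlyvee y)\cdot z=x\succ(y\succ z)$; $(x\succ y)\cdot z=x\succ(y\cdot z)$; $(x\prec y)\cdot z=x\cdot(y\succ z)$; $(x\cdot y)\prec z=x\cdot(y\prec z)$; $(x\cdot y)\cdot z=x\cdot(y\cdot z)$; $(x\curlyvee y)\prec z+(x\star y)\curlyvee z=x\succ(y\curlyvee z)+x\curlyvee(y\star z)$. In particular $(\mathcal A,\cdot)$ is an associative algebra. For associative algebras $(A,\cdot_A)$, $(B,\cdot_B)$, a non-abelian $2$-cocycle on $A$ with values in $B$ is a triple of bilinear maps $\vartriangleright:A\times B\to B$, $\vartriangleleft:B\times A\to B$, $\theta:A\times A\to B$ such that for all $a,b,c\in A$, $x,y\in B$: $(a\cdot_A b)\vartriangleright x+\theta(a,b)\cdot_B x=a\vartriangleright(b\vartriangleright x)$; $(a\vartriangleright x)\vartriangleleft b=a\vartriangleright(x\vartriangleleft b)$; $(x\vartriangleleft a)\vartriangleleft b=x\vartriangleleft(a\cdot_A b)+x\cdot_B\theta(a,b)$; $(a\vartriangleright x)\cdot_B y=a\vartriangleright(x\cdot_B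 y)$; $(x\vartriangleleft a)\cdot_B y=x\cdot_B(a\vartriangleright y)$; $(x\cdot_B y)\vartriangleleft a=x\cdot_B(y\vartriangleleft a)$; $\theta(a,b)\vartriangleleft c+\theta(a\cdot_A b,c)=a\vartriangleright\theta(b,c)+\theta(a,b\cdot_A c)$. A $(\vartriangleright,\vartriangleleft,\theta)$-twisted Rota-Baxter operator is a linear map $r:B\to A$ with $r(x)\cdot_A r(y)=r\big(r(x)\vartriangleright y+x\vartriangleleft r(y)+x\cdot_B y+\theta(r(x),r(y))\big)$ for all $x,y\in B$. Such an $r$ induces the twisted tridendriform algebra $(B,\prec_r,\succ_r,\curlyvee_r,\cdot_B)$ with $x\prec_r y=x\vartriangleleft r(y)$, $x\succ_r y=r(x)\vartriangleright y$, $x\curlyvee_r y=\theta(r(x),r(y))$. *)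

(* Defs.v *)
From HB Require Import structures.
From mathcomp Require Import all_boot all_algebra.

Set Implicit Arguments.
Unset Strict Implicit.
Unset Printing Implicit Defensive.

Import GRing.Theory.
Local Open Scope ring_scope.

(* MathComp's rings are unital, so the non-unital associative algebras needed *)
(* here are given by a product on an lmodType over a field.                   *)

Definition bilinear_op (K : fieldType) (U V W : lmodType K)
    (f : U -> V -> W) : Prop :=
  bilinear_for *:%R *:%R f.

Record assoc_algebra (K : fieldType) (A : lmodType K)
    (mul : A -> A -> A) : Prop := AssocAlgebra {
  assoc_bilinear : bilinear_op mul;
  assoc_associative : associative mul
}.

Record tridend_ops (A : Type) : Type := TridendOps {
  tprec : A -> A -> A;
  tsucc : A -> A -> A;
  tvee : A -> A -> A;
  tdot : A -> A -> A
}.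

Definition tstar (K : fieldType) (A : lmodType K) (T : tridend_ops A)
    (x y : A) : A :=
  tprec T x y + tsucc T x y + tvee T x y + tdot T x y.

Section TwistedTridendriform.

Variables (K : fieldType) (A : lmodType K) (T : tridend_ops A).

Local Notation "x ≺ y" := (tprec T x y) (at level 40, no associativity).
Local Notation "x ≻ y" := (tsucc T x y) (at level 40, no associativity).
Local Notation "x ⋎ y" := (tvee T x y) (at level 40, no associativity).
Local Notation "x ⋅ y" := (tdot T x y) (at level 40, no associativity).
Local Notation "x ⋆ y" := (tstar T x y) (at level 40, no associativity).

Record twisted_tridendriform : Prop := TwistedTridendriform {
  tprec_bilinear : bilinear_op (tprec T);
  tsucc_bilinear : bilinear_op (tsucc T);
  tvee_bilinear : bilinear_op (tvee T);
  tdot_bilinear : bilinear_op (tdot T);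
  tprec_prec : forall x y z, (x ≺ y) ≺ z = x ≺ (y ⋆ z) + x ⋅ (y ⋎ z);
  tsucc_prec : forall x y z, (x ≻ y) ≺ z = x ≻ (y ≺ z);
  tstar_succ : forall x y z, (x ⋆ y) ≻ z + (x ⋎ y) ⋅ z = x ≻ (y ≻ z);
  tsucc_dot : forall x y z, (x ≻ y) ⋅ z = x ≻ (y ⋅ z);
  tprec_dot : forall x y z, (x ≺ y) ⋅ z = x ⋅ (y ≻ z);
  tdot_prec : forall x y z, (x ⋅ y) ≺ z = x ⋅ (y ≺ z);
  tdot_dot : forall x y z, (x ⋅ y) ⋅ z = x ⋅ (y ⋅ z);
  tvee_prec : forall x y z,
    (x ⋎ y) ≺ z + (x ⋆ y) ⋎ z = x ≻ (y ⋎ z) + x ⋎ (y ⋆ z)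
}.

End TwistedTridendriform.

Section TwistedRotaBaxter.

Variables (K : fieldType) (A B : lmodType K).
Variables (mulA : A -> A -> A) (mulB : B -> B -> B).
Variables (lact : A -> B -> B) (ract : B -> A -> B) (theta : A -> A -> B).

Local Notation "a ⋅A b" := (mulA a b) (at level 40, no associativity).
Local Notation "x ⋅B y" := (mulB x y) (at level 40, no associativity).
Local Notation "a ▷ x" := (lact a x) (at level 40, no associativity).
Local Notation "x ◁ a" := (ract x a) (at level 40, no associativity).

Record nonabelian_cocycle : Prop := NonabelianCocycle {
  cocycle_algA : assoc_algebra mulA;
  cocycle_algB : assoc_algebra mulB;
  lact_bilinear : bilinear_op lact;
  ract_bilinear : bilinear_op ract;
  theta_bilinear : bilinear_op theta;
  lact_lact : forall a b x, (a ⋅A b) ▷ x + theta a b ⋅B x = a ▷ (b ▷ x);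
  lact_ract : forall a x b, (a ▷ x) ◁ b = a ▷ (x ◁ b);
  ract_ract : forall x a b, (x ◁ a) ◁ b = x ◁ (a ⋅A b) + x ⋅B theta a b;
  lact_mul : forall a x y, (a ▷ x) ⋅B y = a ▷ (x ⋅B y);
  ract_mul : forall x a y, (x ◁ a) ⋅B y = x ⋅B (a ▷ y);
  mul_ract : forall x y a, (x ⋅B y) ◁ a = x ⋅B (y ◁ a);
  theta_cocycle : forall a b c,
    theta a b ◁ c + theta (a ⋅A b) c = a ▷ theta b c + theta a (b ⋅A c)
}.

Record twisted_rota_baxter (r : B -> A) : Prop := TwistedRotaBaxter {
  trb_cocycle : nonabelian_cocycle;
  trb_linear : linear r;
  trb_mul : forall x y,
    r x ⋅A r y = r (r x ▷ y + x ◁ r y + x ⋅B y + theta (r x) (r y))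
}.

Definition induced_tridend (r : B -> A) : tridend_ops B :=
  TridendOps (fun x y => x ◁ r y) (fun x y => r x ▷ y)
             (fun x y => theta (r x) (r y)) mulB.

End TwistedRotaBaxter.

Lemma induced_tridendP (K : fieldType) (A B : lmodType K)
    (mulA : A -> A -> A) (mulB : B -> B -> B)
    (lact : A -> B -> B) (ract : B -> A -> B) (theta : A -> A -> B)
    (r : B -> A) :
  twisted_rota_baxter mulA mulB lact ract theta r ->
  twisted_tridendriform (induced_tridend mulB lact ract theta r).
Proof.
case=> -[[_ _] [mB1 mA] [l1 l2] [r1 r2] [t1 t2]]
  e1 e2 e3 e4 e5 e6 e7 rlin rM.
have rE x y : r (tstar (induced_tridend mulB lact ract theta r) x y)
    = mulA (r x) (r y).
  rewrite rM /tstar /= [ract _ _ + lact _ _]addrC; congr (r _).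
  by rewrite -!addrA; congr (_ + (_ + _)); exact: addrC.
split=> [||||x y z|x y z|x y z|x y z|x y z|x y z|x y z|x y z] //=;
  rewrite ?rE //.
- by split=> u c x y /=; rewrite ?rlin ?r1 ?r2.
- by split=> u c x y /=; rewrite ?rlin ?l1 ?l2.
- by split=> u c x y /=; rewrite ?rlin ?t1 ?t2.
Qed.

(* Main.v *)
Require Import Defs.
From HB Require Import structures.
From mathcomp Require Import all_boot all_algebra.

Import GRing.Theory.
Local Open Scope ring_scope.

(** Once [tstar T] is known to be associative and bilinear, everything is a
rereading of the axioms of a twisted tridendriform algebra. Seven of its
eight identities, all but associativity of the product [tdot T], are exactly
the seven non-abelian 2-cocycle identities for [tstar T] and [tdot T]; the
Rota-Baxter identity for the identity map is the definition of [tstar T] up to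
the order of the summands; and the induced operations are definitionally the
given ones. Associativity of [tstar T] is the sum of the eight identities:
their left-hand sides add up to the expansion of (x * y) * z, their right-hand
sides to that of x * (y * z) ([tstar_assoc]). *)

Lemma bilinear_opDl (K : fieldType) (U V W : lmodType K) (f : U -> V -> W) :
  bilinear_op f -> forall z, {morph f^~ z : x y / x + y}.
Proof.
by case=> fl _ z x y; have /= := fl z 1 x y; rewrite !scale1r.
Qed.

Lemma bilinear_opDr (K : fieldType) (U V W : lmodType K) (f : U -> V -> W) :
  bilinear_op f -> forall z, {morph f z : x y / x + y}.
Proof.
by case=> _ fr z x y; have /= := fr z 1 x y; rewrite !scale1r.
Qed.

Lemma bilinear_op_add (K : fieldType) (U V W : lmodType K)
    (f g : U -> V -> W) :
  bilinear_op f -> bilinear_op g -> bilinear_op (fun x y => f x y + g x y).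
Proof.
move=> [fl fr] [gl gr]; split=> u c x y /=.
- have /= -> := fl u c x y; have /= -> := gl u c x y.
  by rewrite scalerDr addrACA.
- have /= -> := fr u c x y; have /= -> := gr u c x y.
  by rewrite scalerDr addrACA.
Qed.

Lemma tstar_bilinear (K : fieldType) (A : lmodType K) (T : tridend_ops A) :
  twisted_tridendriform T -> bilinear_op (tstar T).
Proof.
case=> prec_bil succ_bil vee_bil dot_bil _ _ _ _ _ _ _ _.
exact: (bilinear_op_add _ _ _ _ _ _ (bilinear_op_add _ _ _ _ _ _
  (bilinear_op_add _ _ _ _ _ _ prec_bil succ_bil) vee_bil) dot_bil).
Qed.

Lemma tstar_assoc (K : fieldType) (A : lmodType K) (T : tridend_ops A) :
  twisted_tridendriform T -> associative (tstar T).
Proof.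
move=> hT x y z; apply/esym.
have precDl := bilinear_opDl _ _ _ _ _ (tprec_bilinear hT).
have succDr := bilinear_opDr _ _ _ _ _ (tsucc_bilinear hT).
have dotDl := bilinear_opDl _ _ _ _ _ (tdot_bilinear hT).
have dotDr := bilinear_opDr _ _ _ _ _ (tdot_bilinear hT).
(* The inner [tstar] is unfolded only under [tprec T] and [tdot T] on the left
   and under [tsucc T] and [tdot T] on the right: the axioms involve the other
   operations only with [tstar T x y] or [tstar T y z] kept whole. *)
have -> : tstar T (tstar T x y) z =
    tprec T (tprec T x y + tsucc T x y + tvee T x y + tdot T x y) z
    + tsucc T (tstar T x y) z + tvee T (tstar T x y) z
    + tdot T (tprec T x y + tsucc T x y + tvee T x y + tdot T x y) z by [].
have -> : tstar T x (tstar T y z) =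
    tprec T x (tstar T y z)
    + tsucc T x (tprec T y z + tsucc T y z + tvee T y z + tdot T y z)
    + tvee T x (tstar T y z)
    + tdot T x (tprec T y z + tsucc T y z + tvee T y z + tdot T y z) by [].
rewrite !precDl !succDr !dotDl !dotDr.
rewrite (tprec_prec hT) (tsucc_prec hT) (tdot_prec hT).
rewrite (tprec_dot hT) (tsucc_dot hT) (tdot_dot hT) !addrA.
(* The two remaining identities equate sums, whose left-hand sides must first
   be brought together. *)
rewrite [LHS](ACl ((6*10)*(4*7)*1*2*3*5*8*9*11))/=.
rewrite (tstar_succ hT) (tvee_prec hT) !addrA.
by rewrite [LHS](ACl (4*6*1*2*9*3*7*8*5*10)).
Qed.

Lemma tstar_assoc_algebra (K : fieldType) (A : lmodType K)
    (T : tridend_ops A) :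
  twisted_tridendriform T -> assoc_algebra (tstar T).
Proof. by move=> hT; split; [exact: tstar_bilinear | exact: tstar_assoc]. Qed.

Lemma tridend_cocycle (K : fieldType) (A : lmodType K) (T : tridend_ops A) :
  twisted_tridendriform T ->
  nonabelian_cocycle (tstar T) (tdot T) (tsucc T) (tprec T) (tvee T).
Proof.
move=> hT; have star_alg := tstar_assoc_algebra _ _ _ hT.
by case: hT => *; split=> //; split.
Qed.

Lemma tridend_id_rota_baxter (K : fieldType) (A : lmodType K)
    (T : tridend_ops A) :
  twisted_tridendriform T ->
  twisted_rota_baxter (tstar T) (tdot T) (tsucc T) (tprec T) (tvee T) (@id A).
Proof.
move=> hT; split=> [||x y]; [exact: tridend_cocycle | by [] |].
by rewrite /tstar (ACl (2*1*4*3)).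
Qed.

Theorem theorem8p6 (K : fieldType) (A : lmodType K) (T : tridend_ops A)
    (hT : twisted_tridendriform T) :
  [/\ assoc_algebra (tstar T),
      nonabelian_cocycle (tstar T) (tdot T) (tsucc T) (tprec T) (tvee T),
      twisted_rota_baxter (tstar T) (tdot T) (tsucc T) (tprec T) (tvee T)
        (@id A)
    & twisted_tridendriform
        (induced_tridend (tdot T) (tsucc T) (tprec T) (tvee T) (@id A)) /\
      induced_tridend (tdot T) (tsucc T) (tprec T) (tvee T) (@id A) = T].
Proof.
have rb := tridend_id_rota_baxter _ _ _ hT.
split; [exact: tstar_assoc_algebra | exact: tridend_cocycle | exact: rb |].
split; first exact: induced_tridendP rb.
by case: T {hT rb}.
Qed.
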